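(* Assume that $\tilde A(x,y)=E(y)+\left(\frac{5}{3\delta t}-L\right)\|y-x\|^2+\frac56\|y-x\|_M^2$ (a function on $X\times X$) is a KL function. Let $\{u^n\}_n$ (with associated $\{y^n\}_n$ and $\{\lambda_n\}_n$) be a sequence generated by Algorithm FlowBBApe with the NLS line search (described in the context) for minimizing $E=H+F$, and assume that $0\le\lambda_n<\min\left\{\sqrt{\frac{10-6\delta tL}{2+3\delta tL}}-1,\ \sqrt5-1\right\}$. Then the following statements hold. (i) $\lim_{n\to\infty}\mathrm{dist}(0,\partial\tilde A(u^n,y^n))=0$. (ii) The sequence $\{\tilde A(u^n,y^n)\}_n$ is monotonically decreasing with a limit and the sequence $\{u^n\}_n$ is bounded. Specifically, there exists a constant $\tilde\zeta$ such that $\lim_{n\to\infty}\tilde A(u^n,y^n)=\tilde\zeta$. (iii) The sequence $\{u^n\}_n$ converges to a stationary point of $E$; moreover, $\sum_{n=0}^\infty\|u^{n+1}-u^n\|<\infty$.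
   Context: Setting. $X$ is a finite-dimensional Hilbert space; $E=H+F$, where $H:X\to\mathbb{R}\cup\{+\infty\}$ is proper, lower semicontinuous and convex (possibly nonsmooth), and $F$ is a proper function whose gradient $f=\nabla F$ is Lipschitz continuous with constant $L>0$. $E$ is level-bounded: $\{x:E(x)\le a\}$ is bounded (possibly empty) for every $a\in\mathbb{R}$. $M$ is a self-adjoint positive-semidefinite linear operator on $X$, and $\|u\|_M^2:=\langle Mu,u\rangle$. $\partial$ denotes the limiting subdifferential: for $x\in\mathrm{dom}\,g$, $v\in\partial g(x)$ iff there are $x^t\to x$ with $g(x^t)\to g(x)$ and $v^t\to v$ with $\liminf_{y\to x^t}\frac{g(y)-g(x^t)-\langle v^t,y-x^t\rangle}{\|y-x^t\|}\ge0$ for all $t$. A stationary point of $E$ is a point $x$ with $0\in\partial E(x)$. Algorithm FlowBBApe with NLS line search. Choose $u^0$, $0<\delta t<\frac{2}{3L}$, $\alpha>0$, $0<\beta<1$, $\bar\lambda_{\max}>0$, and set $u^{-1}=u^0$. For $n=0,1,2,\dots$ put $\tilde u^n=\frac43u^n-\frac13u^{n-1}$, $H^n(u)=H(u)+\frac{1}{\delta t}\|u-u^n\|^2$, $F^n(u)=\frac{1}{3\delta t}\|u-u^{n-1}\|^2-F(u)-\langle f(u^n)-f(u^{n-1}),u-u^{n-1}\rangle$, and compute $y^n=\arg\min_u\{H^n(u)-\langle\nabla F^n(u^n),u\rangle+\frac12\|u-\tilde u^n\|_M^2\}$, which satisfies the optimality condition $0\in\frac{2}{3\delta t}(3y^n-4u^n+u^{n-1})+M(y^n-\tilde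 u^n)+\partial H(y^n)+2f(u^n)-f(u^{n-1})$. Set $d^n=y^n-u^n$. If $d^n=0$, stop and return $u^n$. Otherwise perform the line search (NLS): if $\langle\nabla E(y^n),d^n\rangle>0$, set $u^{n+1}=y^n$ (that is, $\lambda_n=0$) and pass to the next iteration (the test is stated with the gradient $\nabla E(y^n)$ in this form, although $H$ is allowed to be nonsmooth). If not, set $\lambda_n=\bar\lambda_{\max}$ and, while $E(y^n+\lambda_nd^n)>E(y^n)-\alpha\lambda_n\|d^n\|^2$, replace $\lambda_n$ by $\beta\lambda_n$; then set $u^{n+1}=y^n+\lambda_nd^n$ and pass to the next iteration. KL function. A proper closed function $g$ on a finite-dimensional space is a KL function if for every critical point $\bar x$ of $g$ (i.e. $0\in\partial g(\bar x)$) there exist $\nu\in(0,+\infty]$, a neighborhood $\mathcal{O}$ of $\bar x$, and a continuous concave function $\psi:[0,\nu)\to[0,+\infty)$ with $\psi(0)=0$, continuously differentiable on $(0,\nu)$ with $\psi'>0$ there, such that $\psi'(g(x)-g(\bar x))\cdot\mathrm{dist}(0,\partial g(x))\ge1$ for all $x\in\mathcal{O}$ with $g(\bar x)<g(x)<g(\bar x)+\nu$. *)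

(* Defs.v *)
From HB Require Import structures.
From mathcomp Require Import all_boot all_order all_algebra sesquilinear.
From mathcomp Require Import all_classical all_reals all_analysis.

Set Implicit Arguments.
Unset Strict Implicit.
Unset Printing Implicit Defensive.

Import Order.TTheory GRing.Theory Num.Theory.
Import numFieldNormedType.Exports.

Local Open Scope classical_set_scope.
Local Open Scope ring_scope.

(* Finite-dimensional normed spaces. A finite-dimensional Hilbert space is a
   [X : normedVectType R] with a form [ip : {dot X for idfun}] such that
   [`|x| = Num.sqrt (ip x x)] for all [x]; completeness is automatic. *)
#[short(type="normedVectType")]
HB.structure Definition NormedVector (R : numFieldType) :=
  {V of Vector R V & NormedModule R V}.

Section VariationalAnalysis.
Context {R : realType} {Y : normedModType R}.
(* Topological notions on [Y] are those of the library; norms are the ones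
   induced by the inner product [ip]. On a product the library norm is the
   maximum norm, which gives the same topology as [prod_ip] below but is not
   the Hilbert norm. *)
Variable ip : Y -> Y -> R.

Definition hnorm (x : Y) : R := Num.sqrt (ip x x).

Definition is_gradient (g : Y -> R) (x v : Y) : Prop :=
  differentiable g x /\ forall h, 'd g x h = ip v h.

Definition is_egradient (g : Y -> \bar R) (x v : Y) : Prop :=
  (\forall z \near x, g z \is a fin_num) /\ is_gradient (fine \o g) x v.

Definition eproper (g : Y -> \bar R) : Prop :=
  (forall x, g x != -oo%E) /\ exists x, (g x < +oo)%E.

(* Convexity of an extended-valued function that never takes the value -oo. *)
Definition econvex (g : Y -> \bar R) : Prop :=
  forall (x y : Y) (t : R), 0 < t < 1 ->
  (g (t *: x + (1 - t) *: y)%R <= t%:E * g x + (1 - t)%:E * g y)%E.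

Definition level_bounded (g : Y -> \bar R) : Prop :=
  forall a : R, bounded_set [set x | (g x <= a%:E)%E].

Definition is_argmin (g : Y -> \bar R) (y : Y) : Prop :=
  forall z, (g y <= g z)%E.

Definition frechet_subdiff (g : Y -> \bar R) (x : Y) : set Y :=
  [set v | g x \is a fin_num /\
    (0 <= limf_einf (fun z => (g z - g x - (ip v (z - x)%R)%:E)
                              * ((hnorm (z - x)%R)^-1)%:E) x^')%E].

Definition subdiff (g : Y -> \bar R) (x : Y) : set Y :=
  [set v | g x \is a fin_num /\
    exists (xs vs : nat -> Y),
      [/\ xs @ \oo --> x, g (xs t) @[t --> \oo] --> g x, vs @ \oo --> v &
          forall t, frechet_subdiff g (xs t) (vs t)]].

(* The distance from 0 to [A], equal to +oo when [A] is empty. *)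
Definition dist0 (A : set Y) : \bar R :=
  ereal_inf [set (hnorm v)%:E | v in A].

Definition desingularizing (nu : \bar R) (psi : R -> R) : Prop :=
  let I := [set s : R | 0 <= s /\ (s%:E < nu)%E] in
  [/\ psi 0 = 0,
      forall s, I s -> 0 <= psi s,
      {within I, continuous psi},
      convex_function (E := R^o) I (\- psi) &
      forall s, 0 < s -> (s%:E < nu)%E ->
        [/\ derivable psi s 1, {for s, continuous (derive1 psi)} & 0 < derive1 psi s]].

Definition KL_function (g : Y -> \bar R) : Prop :=
  [/\ eproper g, lower_semicontinuous g &
    forall xb, subdiff g xb 0 ->
    exists (nu : \bar R) (O : set Y) (psi : R -> R),
      [/\ (0 < nu)%E, nbhs xb O, desingularizing nu psi &
        forall x, O x -> (g xb < g x)%E -> (g x < g xb + nu)%E ->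
        (1 <= (derive1 psi (fine (g x - g xb)))%:E * dist0 (subdiff g x))%E]].

End VariationalAnalysis.

Definition prod_ip {R : realType} {X : normedModType R} (ip : X -> X -> R)
    (p q : X * X) : R :=
  ip p.1 q.1 + ip p.2 q.2.

Section FlowBBApe.
Context {R : realType} {X : normedModType R}.
Variables (ip : X -> X -> R) (H : X -> \bar R) (F : X -> R) (f : X -> X).
Variables (M : X -> X) (L dt alpha beta lmax : R).

Definition energy (x : X) : \bar R := (H x + (F x)%:E)%E.

Definition sqnormM (x : X) : R := ip (M x) x.

Definition Atilde (p : X * X) : \bar R :=
  (energy p.2 + ((5 / (3 * dt) - L) * `|p.2 - p.1| ^+ 2
                 + 5 / 6 * sqnormM (p.2 - p.1))%R%:E)%E.

(* In the next three definitions [v] is the current iterate and [w] the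
   previous one. *)
Definition extrapolation (v w : X) : X := (4 / 3) *: v - (1 / 3) *: w.

Definition Hn (v u : X) : \bar R := (H u + (1 / dt * `|u - v| ^+ 2)%R%:E)%E.

Definition Fn (v w u : X) : R :=
  1 / (3 * dt) * `|u - w| ^+ 2 - F u - ip (f v - f w) (u - w).

Definition prox_step (v w y : X) : Prop :=
  exists2 g, is_gradient ip (Fn v w) v g &
    is_argmin (fun u => Hn v u
      + (- ip g u + 1 / 2 * sqnormM (u - extrapolation v w))%R%:E)%E y.

(* The test of the while loop at the trial step [t], with [d = y^n - u^n]. *)
Definition rejected (y d : X) (t : R) : Prop :=
  (energy y - (alpha * t * `|d| ^+ 2)%R%:E < energy (y + t *: d)%R)%E.

(* The test [ip (grad E y) d > 0] has a definite outcome only if [E] has a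
   gradient at [y]. Where it has none, no outcome is imposed and either branch
   may be taken, so any convention for the nonsmooth case is covered. *)
Definition NLS (y d : X) (lam : R) (unext : X) : Prop :=
  ((forall g, is_egradient ip energy y g -> 0 < ip g d) /\
   lam = 0 /\ unext = y) \/
  ((forall g, is_egradient ip energy y g -> ~ (0 < ip g d)) /\
   (exists k : nat, [/\ lam = beta ^+ k * lmax, ~ rejected y d lam &
      forall j : nat, (j < k)%N -> rejected y d (beta ^+ j * lmax)]) /\
   unext = y + lam *: d).

(* An infinite run, i.e. one in which the stopping test [d^n = 0] never
   succeeds. As [0.-1 = 0], [u n.-1] encodes the convention u^{-1} = u^0. *)
Definition FlowBBApe_NLS (u y : nat -> X) (lam : nat -> R) : Prop :=
  forall n : nat,
    [/\ prox_step (u n) (u n.-1) (y n),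
        y n - u n != 0 &
        NLS (y n) (y n - u n) (lam n) (u n.+1)].

End FlowBBApe.

(* Main.v *)
Require Import Defs.
From HB Require Import structures.
From mathcomp Require Import all_boot all_order all_algebra sesquilinear.
From mathcomp Require Import all_classical all_reals all_analysis.
From mathcomp Require Import ring lra.

Set Implicit Arguments.
Unset Strict Implicit.
Unset Printing Implicit Defensive.

Import Order.TTheory GRing.Theory Num.Theory.
Import numFieldNormedType.Exports.

Local Open Scope classical_set_scope.
Local Open Scope ring_scope.

(** Each proximal step minimizes a strongly convex model of E, in which the
    extrapolation and the delayed gradient contribute errors controlled by the
    last displacement p = u n - u n.-1. Convexity of H turns minimality into a global subgradient
    inequality for H at y n (prox_subgradP). Combining it with the quadratic
    upper bound on F and Young's inequality bounds the merit value
    A (u n, y n) by E (u n) plus multiples of |p|^2 and of the M-seminorm of p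
    (one_step). Since p = (1 + lam) d for the previous direction d, and the line
    search never increases E past y n.-1, the merit value drops by
    c1 - kappa (1 + lam)^2 times |d|^2, with a similar term in the M-seminorm.
    The bound on lam is exactly positivity of these two coefficients; it is
    uniform in n because the accepted steps lie in the discrete set of the
    beta^k lmax together with 0 (step_ratio, sufficient_decrease).

    The same subgradient inequality yields explicit subgradients of E and of the
    merit function whose norms are at most C (|d_n| + |d_{n-1}|)
    (Aslope_norm, Eslope_norm). Level boundedness and lower semicontinuity
    bound the merit values from below, so they converge, the directions d_n tend
    to 0, and hence so do these subgradients.

    For the convergence of the whole sequence, take a cluster point xb of u.
    Lower semicontinuity gives E xb <= lim A (u n, y n), and the subgradient
    inequality tested at xb gives the converse, so xb is critical for E and
    (xb, xb) for the merit function, at the limiting level (energy_limit,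
    critical_energy, critical_Atilde). Near (xb, xb) the KL inequality, concavity
    of the desingularizing function psi and the decrease bound |d_n| by the drop
    of Phi_n = 2 (C / c) psi (s_n) + |d_{n-1}| / 2, where s_n is the distance of
    the merit value to its limit (kl_step). Therefore |u n - xb| + 3 Phi_n cannot
    increase as long as u n stays near xb; being small somewhere along the
    subsequence, it keeps the sequence trapped, and the steps are summable
    (finite_length_of_descent). Working at one cluster point avoids any uniform
    version of the KL inequality on the cluster set. *)

(** * Inner products *)

Section InnerProduct.
Context {R : realType} {X : normedModType R} (ip : {dot X for idfun}).
Hypothesis hip : forall x : X, `|x| = Num.sqrt (ip x x).

Lemma ipC x y : ip x y = ip y x.
Proof. by rewrite hermC expr0 mul1r. Qed.

Lemma ipZr a x y : ip x (a *: y) = a * ip x y.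
Proof. by rewrite linearZr_LR. Qed.

Lemma ipZl a x y : ip (a *: x) y = a * ip x y.
Proof. by rewrite linearZl_LR. Qed.

Lemma ipDl x y z : ip (x + y) z = ip x z + ip y z.
Proof. by rewrite linearDl. Qed.

Lemma ipDr x y z : ip z (x + y) = ip z x + ip z y.
Proof. by rewrite linearDr. Qed.

Lemma ipNl x z : ip (- x) z = - ip x z.
Proof. by rewrite linearNl. Qed.

Lemma ipNr x z : ip z (- x) = - ip z x.
Proof. by rewrite linearNr. Qed.

Definition ipE := (ipDl, ipDr, ipNl, ipNr, ipZl, ipZr).

Lemma ip_ge0 x : 0 <= ip x x.
Proof.
have [->|x0] := eqVneq x 0; first by rewrite linear0l.
by rewrite ltW// neq0_dnorm_gt0.
Qed.

Lemma ipxx x : ip x x = `|x| ^+ 2.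
Proof. by rewrite hip sqr_sqrtr// ip_ge0. Qed.

Lemma cauchy_schwarz x y : `|ip x y| <= `|x| * `|y|.
Proof.
have [->|y0] := eqVneq y 0; first by rewrite linear0r !normr0 mulr0.
rewrite -ler_sqr ?nnegrE ?mulr_ge0// real_normK ?num_real// exprMn -!ipxx.
have yy0 : 0 < ip y y by rewrite neq0_dnorm_gt0.
have := ip_ge0 (ip y y *: x - ip x y *: y).
rewrite !ipE (ipC y x) => h.
have {}h : 0 <= ip y y * (ip x x * ip y y - ip x y ^+ 2) by lra.
by rewrite pmulr_rge0// subr_ge0 in h.
Qed.

Lemma ip_le x y : ip x y <= `|x| * `|y|.
Proof. exact: le_trans (ler_norm _) (cauchy_schwarz x y). Qed.

End InnerProduct.

(** * Compactness in finite dimension *)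

Section FiniteDimension.
Context {R : realType} {X : normedVectType R}.
Import VectorInternalTheory.
Let N := dim X.
Local Notation coords := (@v2r R X).
Local Notation vect := (@r2v R X).

Lemma r2v_bounded : exists2 K : R, 0 <= K & forall c : 'rV[R]_N, `|vect c| <= K * `|c|.
Proof.
exists (\sum_i `|vect (delta_mx 0 i : 'rV[R]_N)|); first exact: sumr_ge0.
move=> c; rewrite [in leLHS](row_sum_delta c) linear_sum/= mulr_suml.
apply: (le_trans (ler_norm_sum _ _ _)); apply: ler_sum => i _.
rewrite linearZ/= normrZ mulrC ler_wpM2l//.
rewrite [leRHS]/Num.Def.normr/= mx_normrE.
exact: (le_trans _ (le_bigmax _ _ (ord0, i))).
Qed.

(** Equivalence of norms: the norm transported from X has a positive minimum on
    the compact unit sphere of the coordinate space. *)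
Lemma v2r_bounded : exists2 K : R, 0 < K & forall x : X, `|coords x| <= K * `|x|.
Proof.
have [K K0 hK] := r2v_bounded.
pose S := [set c : 'rV[R]_N | `|c| = 1].
(* In dimension 0 the sphere is empty and every coordinate vector vanishes. *)
have [S0|/set0P S0] := eqVneq S set0.
  exists 1 => // x; rewrite mul1r.
  suff -> : coords x = 0 :> 'rV[R]_N by rewrite normr0.
  apply/eqP/negP => /negP v0.
  have : S (`|coords x|^-1 *: coords x).
    by rewrite /S/= normrZ normfV normr_id mulVf// normr_eq0.
  by rewrite S0.
have cS : compact S.
  apply: bounded_closed_compact.
    by exists 1; split => // M M1 c /= ->; exact: ltW.
  have -> : S = (fun c : 'rV[R]_N => `|c|) @^-1` [set 1] by [].
  apply: closed_comp => [c _|]; first exact: norm_continuous.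
  exact: closed_eq.
have cn : {within S, continuous (fun c : 'rV[R]_N => `|vect c|)}.
  apply: continuous_subspaceT => c.
  apply: continuous_comp; last exact: norm_continuous.
  apply/(@cvgrPdist_le _ _ _ (nbhs c)) => e e0.
  have K1 : 0 < K + 1 by rewrite ltr_wpDl.
  apply/(@nbhs_ballP _ 'rV[R]_N); exists ((K + 1)^-1 * e) => /=.
    by rewrite mulr_gt0 ?invr_gt0.
  move=> d; rewrite -ball_normE /= => /ltW cd; rewrite -linearB/= (le_trans (hK _))//.
  apply: (@le_trans _ _ ((K + 1) * `|c - d|)); first by rewrite ler_wpM2r// lerDl.
  by rewrite -ler_pdivlMl.
have [c /set_mem Sc hc] := EVT_min_rV S0 cS cn.
have m0 : 0 < `|vect c|.
  rewrite normr_gt0; apply/eqP => c0.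
  have : c = 0 by rewrite -(@r2vK R X c) c0 linear0.
  by move=> c00; move: Sc; rewrite /S/= c00 normr0 => /eqP; rewrite eq_sym oner_eq0.
exists (`|vect c|^-1) => [|x]; first by rewrite invr_gt0.
rewrite ler_pdivlMl//.
have [->|v0] := eqVneq (coords x : 'rV[R]_N) 0; first by rewrite normr0 mulr0.
have nv0 : 0 < `|coords x| by rewrite normr_gt0.
have /mem_set/hc : S (`|coords x|^-1 *: coords x).
  by rewrite /S/= normrZ normfV normr_id mulVf// gt_eqF.
by rewrite linearZ/= v2rK normrZ normfV normr_id ler_pdivlMl// mulrC.
Qed.

Lemma linear_findim_bounded (Y : normedModType R) (f : {linear X -> Y}) :
  exists2 K : R, 0 < K & forall x, `|f x| <= K * `|x|.
Proof.
have [K K0 hK] := v2r_bounded.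
pose C := \sum_i `|f (vect (delta_mx 0 i : 'rV[R]_N))|.
have C0 : 0 <= C by exact: sumr_ge0.
exists ((C + 1) * K) => [|x]; first by rewrite mulr_gt0// ltr_wpDl.
rewrite -mulrA; apply: (@le_trans _ _ (C * `|coords x|)); last first.
  by rewrite ler_pM// lerDl.
rewrite -{1}(v2rK x) {1}(row_sum_delta (coords x)) !linear_sum/= /C mulr_suml.
apply: (le_trans (ler_norm_sum _ _ _)); apply: ler_sum => i _.
rewrite !linearZ/= normrZ mulrC ler_wpM2l//.
rewrite [leRHS]/Num.Def.normr/= mx_normrE; exact: (le_trans _ (le_bigmax _ _ (ord0, i))).
Qed.

(** Bolzano-Weierstrass. The indices k only satisfy i <= k i, which is enough to
    transfer limits to the subsequence. *)
Lemma bounded_seq_cluster (x_ : nat -> X) (C : R) :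
  (forall n, `|x_ n| <= C) ->
  exists (x : X) (k : nat -> nat), (forall i, (i <= k i)%N) /\ x_ (k i) @[i --> \oo] --> x.
Proof.
move=> xC; have [K K0 hK] := v2r_bounded; have [K' K'0 hK'] := r2v_bounded.
pose A := [set c : 'rV[R]_N | `|c| <= K * C].
have cA : compact A.
  apply: bounded_closed_compact.
    by exists (K * C); split => [|M M1 c /= /le_trans]; [exact: num_real|apply; exact: ltW].
  have -> : A = (fun c : 'rV[R]_N => `|c|) @^-1` [set x | x <= K * C] by [].
  apply: closed_comp => [c _|]; first exact: norm_continuous.
  exact: closed_le.
pose v_ n : 'rV[R]_N := coords (x_ n).
have [c [_ cc]] : A `&` cluster (v_ @ \oo) !=set0.
  apply: cA; exists 0%N => // n _.
  by rewrite /A/= (le_trans (hK _))// ler_wpM2l// ltW.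
have /choice[k hk] : forall i : nat, exists n, (i <= n)%N /\ `|c - v_ n| < i.+1%:R^-1.
  move=> i; have h1 : (v_ @ \oo) (v_ @` [set n | (i <= n)%N]).
    by exists i => // n /= ni; exists n.
  have h2 : nbhs c (ball c i.+1%:R^-1) by apply: nbhsx_ballx; rewrite invr_gt0.
  have [_ [[n /= ni <-]]] := cc _ _ h1 h2.
  by rewrite -ball_normE /= => h; exists n.
exists (vect c), k; split => [i|]; first by case: (hk i).
apply/cvgrPdist_le => e e0.
have K1 : 0 < K' + 1 by rewrite ltr_wpDl.
near=> i; rewrite /= -(v2rK (x_ (k i))) -linearB/= (le_trans (hK' _))//.
apply: (@le_trans _ _ ((K' + 1) * `|c - v_ (k i)|)).
  by rewrite ler_wpM2r// lerDl.
rewrite -ler_pdivlMl// (le_trans (ltW (hk i).2))// ltW//; near: i.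
have e'0 : 0 < (K' + 1)^-1 * e by rewrite mulr_gt0 ?invr_gt0.
exact: (near_infty_natSinv_lt (PosNum e'0)).
Unshelve. all: by end_near. Qed.

End FiniteDimension.

(** * Smooth functions and their gradients *)

Lemma taylor1_le (R : realType) (phi dphi : R -> R) (C : R) :
  (forall t : R, is_derive t 1 phi (dphi t)) ->
  (forall t, 0 <= t -> dphi t - dphi 0 <= C * t) ->
  phi 1 - phi 0 - dphi 0 <= C / 2.
Proof.
move=> dp hC.
pose g t := phi t - t * dphi 0 - C / 2 * t ^+ 2.
have dg (t : R) : is_derive t 1 g (dphi t - dphi 0 - C * t).
  rewrite /g; apply: is_derive_eq.
  by rewrite /GRing.scale/=; field.
have cg : {within `[0, 1], continuous g}.
  apply: continuous_subspaceT => t.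
  apply: differentiable_continuous; apply/derivable1_diffP.
  exact: (@ex_derive _ _ _ _ _ _ _ (dg t)).
have [c /[!in_itv]/= /andP[c0 _]] := MVT ltr01 (fun t _ => dg t) cg.
have := hC c (ltW c0); rewrite /g; lra.
Qed.

Section Gradient.
Context {R : realType} {X : normedModType R} (ip : {dot X for idfun}).
Hypothesis hip : forall x : X, `|x| = Num.sqrt (ip x x).

Lemma is_gradient_line (g : X -> R) (v x h : X) (t : R) :
  is_gradient ip g (t *: h + x) v ->
  is_derive t 1 (fun s => g (s *: h + x)) (ip v h).
Proof.
move=> [dg eg]; have dh : derivable g (t *: h + x) h := diff_derivable dg.
have e : (fun s : R => s^-1 *: (((fun s => g (s *: h + x)) \o shift t) (s *: (1 : R))
      - g (t *: h + x))) =
    (fun s : R => s^-1 *: ((g \o shift (t *: h + x)) (s *: h) - g (t *: h + x))).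
  apply/funext => s /=; congr (_ *: (g _ - _)).
  by rewrite scalerDl addrA /GRing.scale/= mulr1.
split; first by rewrite /derivable e.
by rewrite -eg -deriveE// /derive e.
Qed.

(** Identifies a gradient from a quadratic remainder, which spares computing
    differentials of composite expressions. Along the line in direction
    k = v - c the difference quotients tend both to the pairing with v and to
    the pairing with c, so |k|^2 = 0. *)
Lemma is_gradient_unique (g : X -> R) (v c x : X) (K : R) :
  is_gradient ip g x v ->
  (forall k, `|g (x + k) - g x - ip c k| <= K * `|k| ^+ 2) -> v = c.
Proof.
move=> gv hK; apply/eqP; rewrite -subr_eq0; apply/eqP; set k := v - c.
have := @is_gradient_line g v x k 0.
rewrite scale0r add0r => /(_ gv) [dl el].
have l1 : (fun s : R => s^-1 *: (g (s *: k + x) - g x)) @ 0^' --> ip v k.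
  have e : (fun s : R => s^-1 *: (((fun s : R => g (s *: k + x)) \o shift 0) (s *: (1 : R))
      - g (0 *: k + x))) = (fun s : R => s^-1 *: (g (s *: k + x) - g x)).
    apply/funext => s /=; have -> : s *: (1 : R) = s by exact: mulr1.
    by rewrite addr0 scale0r add0r.
  by rewrite -el; have := dl; rewrite /derivable /derive e.
have l2 : (fun s : R => s^-1 *: (g (s *: k + x) - g x)) @ 0^' --> ip c k.
  apply/cvgrPdist_le => e e0; near=> s.
  have s0 : s != 0 by near: s; exact: nbhs_dnbhs_neq.
  rewrite distrC; have -> : s^-1 *: (g (s *: k + x) - g x) - ip c k =
      s^-1 * (g (x + s *: k) - g x - ip c (s *: k)).
    rewrite ipZr (addrC x) /GRing.scale/= [in RHS]mulrBr; congr (_ - _).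
    by rewrite mulKf.
  rewrite normrM normfV ler_pdivrMl ?normr_gt0//.
  rewrite (le_trans (hK _))// normrZ exprMn mulrCA expr2 -mulrA ler_wpM2l//.
  have K0 : 0 < `|K| * `|k| ^+ 2 + 1 by rewrite ltr_wpDl// mulr_ge0.
  apply: (@le_trans _ _ (`|s| * (`|K| * `|k| ^+ 2 + 1))).
    rewrite ler_wpM2l// (le_trans (ler_norm _))// normrM ler_wpDr//.
    by rewrite [`|_ ^+ 2|]ger0_norm// sqr_ge0.
  rewrite -ler_pdivlMr//; near: s; apply: dnbhs0_le; exact: divr_gt0.
have e : ip v k = ip c k.
  by rewrite -(cvg_lim (@norm_hausdorff _ _) l1) -(cvg_lim (@norm_hausdorff _ _) l2).
have : ip k k = 0 by rewrite {1}/k ipDl ipNl e subrr.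
by rewrite (ipxx hip) => /eqP; rewrite sqrf_eq0 normr_eq0 => /eqP.
Unshelve. all: by end_near. Qed.

(** Restrict F to the segment from x to x + h: its derivative moves away from the
    initial one at rate at most L |h|^2. *)
Lemma descent_lemma (F : X -> R) (f : X -> X) (L : R) :
  (forall x, is_gradient ip F x (f x)) ->
  (forall x y, `|f x - f y| <= L * `|x - y|) ->
  forall x h, `|F (x + h) - F x - ip (f x) h| <= L / 2 * `|h| ^+ 2.
Proof.
move=> Fg Lf x h.
have Lh t : 0 <= t -> `|ip (f (t *: h + x)) h - ip (f (0 *: h + x)) h| <= (L * `|h| ^+ 2) * t.
  move=> t0; rewrite -linearBl/= (le_trans (cauchy_schwarz hip _ _))//.
  rewrite expr2 !mulrA mulrAC ler_wpM2r// (le_trans (Lf _ _))//.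
  by rewrite scale0r add0r addrK normrZ ger0_norm// mulrAC -mulrA.
have d1 (t : R) := @is_gradient_line F (f (t *: h + x)) x h t (Fg _).
have d2 (t : R) : is_derive t 1 (fun s => - F (s *: h + x)) (- ip (f (t *: h + x)) h).
  exact: is_deriveN.
have := @taylor1_le _ _ (fun t => ip (f (t *: h + x)) h) (L * `|h| ^+ 2) d1.
have := @taylor1_le _ _ (fun t => - ip (f (t *: h + x)) h) (L * `|h| ^+ 2) d2.
rewrite !scale0r !add0r !scale1r (addrC h) => h1 h2.
rewrite ler_norml; apply/andP; split.
  have : - F (x + h) - - F x - - ip (f x) h <= L * `|h| ^+ 2 / 2; last by lra.
  by apply: h1 => t t0; have := Lh t t0; rewrite ler_norml scale0r add0r => /andP[]; lra.
have : F (x + h) - F x - ip (f x) h <= L * `|h| ^+ 2 / 2; last by lra.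
by apply: h2 => t t0; have := Lh t t0; rewrite ler_norml scale0r add0r => /andP[]; lra.
Qed.

End Gradient.

(** * Subdifferentials and desingularizing functions *)

Section Subdifferential.
Context {R : realType} {Y : normedModType R} (ip : Y -> Y -> R).

(** A quadratic error is negligible against the norm, so a global quadratic
    minorant certifies a Frechet subgradient. *)
Lemma frechet_of_quadratic (g : Y -> \bar R) (x v : Y) (K : R) :
  g x \is a fin_num ->
  (forall e, 0 < e -> \forall z \near x, hnorm ip (z - x) <= e) ->
  (forall z, (g x + (ip v (z - x) - K * hnorm ip (z - x) ^+ 2)%:E <= g z)%E) ->
  frechet_subdiff ip g x v.
Proof.
move=> gx hn hK; split => //; rewrite limf_einfE.
apply/lee_addgt0Pr => e e0.
pose d := e / (`|K| + 1).
have K0 : 0 < `|K| + 1 by rewrite ltr_wpDl.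
have d0 : 0 < d by rewrite divr_gt0.
rewrite -leeBlDr// sub0e.
apply: ereal_sup_ge.
exists (ereal_inf [set ((g z - g x - (ip v (z - x)%R)%:E)
    * ((hnorm ip (z - x)%R)^-1)%:E)%E | z in [set z | hnorm ip (z - x) <= d]]).
  exists [set z | hnorm ip (z - x) <= d] => //.
  rewrite /dnbhs /within /=; apply: filterS (hn d d0) => z hz _; exact: hz.
apply: le_ereal_inf_tmp => _ [z /= zd <-].
have n0 : 0 <= hnorm ip (z - x) by rewrite sqrtr_ge0.
have := hK z; set n := hnorm ip (z - x) in n0 zd *.
rewrite -(fineK gx); case: (g z) => [r| |] //=; last first.
  move=> _; rewrite /=.
  (* Where hnorm vanishes the quotient is 0, since the inverse of 0 is 0. *)
  have [<-|n1] := eqVneq 0 n; first by rewrite invr0 mule0 lee_fin oppr_le0 ltW.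
  by rewrite /= addye// gt0_mulye ?leey// lte_fin invr_gt0 lt_neqAle n1.
rewrite -EFinD lee_fin => h.
rewrite -!EFinB -EFinM lee_fin.
have [<-|n1] := eqVneq 0 n; first by rewrite invr0 mulr0 oppr_le0 ltW.
have {}n0 : 0 < n by rewrite lt_neqAle n1.
rewrite ler_pdivlMr//.
have h1 : K * n ^+ 2 <= n * e.
  rewrite expr2 mulrA mulrC ler_wpM2l ?(ltW n0)//.
  apply: (@le_trans _ _ ((`|K| + 1) * n)).
    by rewrite ler_wpM2r ?(ltW n0)// (le_trans (ler_norm _))// lerDl.
  by rewrite mulrC -ler_pdivlMr.
lra.
Qed.

Lemma frechet_subdiffW (g : Y -> \bar R) (x v : Y) :
  frechet_subdiff ip g x v -> subdiff ip g x v.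
Proof.
move=> fv; split; first by case: fv.
exists (fun=> x), (fun=> v); split => //; exact: cvg_cst.
Qed.

Lemma dist0_ge0 (A : set Y) : (0 <= dist0 ip A)%E.
Proof. by apply: le_ereal_inf_tmp => _ [v _ <-]; rewrite lee_fin sqrtr_ge0. Qed.

Lemma dist0_le (A : set Y) v : A v -> (dist0 ip A <= (hnorm ip v)%:E)%E.
Proof. by move=> Av; apply: ereal_inf_lbound; exists v. Qed.

End Subdifferential.

Section Desingularizing.
Context {R : realType}.

(** Tangent-line inequality of a concave function: the difference quotients
    of psi just left of s are at most its slope over [s', s], and they tend to the
    derivative. *)
Lemma desingularizing_concave (nu : \bar R) (psi : R -> R) (s s' : R) :
  desingularizing nu psi -> 0 <= s' -> s' <= s -> 0 < s -> (s%:E < nu)%E ->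
  derive1 psi s * (s - s') <= psi s - psi s'.
Proof.
move=> [_ _ _ cvx dpsi] s'0 s's s0 snu.
have [ds _ _] := dpsi s s0 snu.
have [->|ss'] := eqVneq s' s; first by rewrite !subrr mulr0.
have {ss'}s's : s' < s by rewrite lt_neqAle ss'.
have s'nu : (s'%:E < nu)%E by apply: lt_trans snu; rewrite lte_fin.
rewrite -ler_pdivlMr ?subr_gt0//.
have l1 : (fun t : R => t^-1 *: (psi (t + s) - psi s)) @ 0^' --> derive1 psi s.
  rewrite derive1E; have := ds; rewrite /derivable /derive /=.
  by under eq_fun do rewrite /GRing.scale/= mulr1.
have l2 := cvg_dnbhs_at_left l1.
apply: (cvgr_to_le l2); near=> t.
have t0 : t < 0 by near: t; exact: nbhs_left_lt.
have ts : s' - s < t by near: t; apply: nbhs_left_gt; lra.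
have ss : s' - s < 0 by lra.
have r01 : 0 <= t / (s' - s) <= 1.
  by rewrite ler_ndivrMr// ler_ndivlMr// mul0r mul1r !ltW.
(* t + s is the convex combination of s' and s with weight t / (s' - s) on s'. *)
have := cvx (Itv01 (andP r01).1 (andP r01).2) s' s.
rewrite !inE /= => /(_ (conj s'0 s'nu) (conj (ltW s0) snu)).
rewrite !convRE /= /unstable.onem.
set a := t / (s' - s).
have ta : t = a * (s' - s) by rewrite divfK// lt_eqF.
have a0 : 0 < a by rewrite /a ltr_ndivlMr// mul0r.
set c := (X in - psi X <= _).
have -> : c = t + s by transitivity (a * s' + (1 - a) * s) => //; rewrite ta; ring.
move=> h; rewrite ler_pdivlMr ?subr_gt0// /GRing.scale/= mulrC mulrA.
have -> : (s - s') / t = - a^-1 by rewrite ta; field; rewrite gt_eqF//= lt_eqF.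
rewrite mulNr -mulrN ler_pdivrMl//; lra.
Unshelve. all: by end_near.
Qed.

(** The continuity of psi at 0 is only relative to [0, nu), which a nonnegative
    null sequence eventually enters. *)
Lemma desingularizing_cvg0 (nu : \bar R) (psi : R -> R) (a : nat -> R) :
  desingularizing nu psi -> (0 < nu)%E -> (forall n, 0 <= a n) ->
  a @ \oo --> 0 -> psi (a n) @[n --> \oo] --> 0.
Proof.
move=> [psi0 _ cpsi _ _] nu0 a0 acvg.
have I0 : [set s : R | 0 <= s /\ (s%:E < nu)%E] 0 by split.
have := cpsi 0; rewrite /continuous_at.
rewrite /from_subspace => h.
have {}h : psi x @[x --> within [set s : R | 0 <= s /\ (s%:E < nu)%E] (nbhs (0 : R))] --> psi 0.
  by rewrite (nbhs_subspace_in I0); exact: h.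
rewrite -[X in _ --> X]psi0; apply: cvg_comp h => U hU /=.
have aI : \forall n \near \oo, 0 <= a n /\ ((a n)%:E < nu)%E.
  case: nu nu0 {cpsi I0 hU} => [r| |]//; last first.
    by move=> _; apply: nearW => n; split => //; rewrite ltry.
  rewrite lte_fin => r0; near=> n; split=> //; rewrite lte_fin.
  by near: n; exact: (cvgr_lt _ acvg).
have aU : \forall n \near \oo, 0 <= a n /\ ((a n)%:E < nu)%E -> U (a n) by exact: acvg hU.
by near=> n; apply: (near aU n) => //; exact: (near aI n).
Unshelve. all: by end_near. Qed.

End Desingularizing.

(** * Elementary facts on real numbers and sequences *)

Lemma le0_of_small_multiples (R : realType) (a B : R) :
  0 <= B -> (forall t, 0 < t < 1 -> a <= t * B) -> a <= 0.
Proof.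
move=> B0 h; rewrite leNgt; apply/negP => a0.
have c0 : 0 < a + B + 1 by lra.
(* This weight lies in the unit interval and makes t * B < a. *)
have := h (a / (a + B + 1)); rewrite divr_gt0//= ltr_pdivrMr// mul1r.
rewrite mulrAC ler_pdivlMr// ler_pM2l//; lra.
Qed.

(** Trapping argument: as long as u n is within r of xb, the triangle inequality
    makes |u n - xb| + Phi n nonincreasing, so once it is below r the
    sequence never leaves the ball, and the steps telescope against Phi. *)
Lemma finite_length_of_descent (R : realType) (X : normedModType R)
    (u : nat -> X) (xb : X) (Phi : nat -> R) (N0 : nat) (r : R) :
  0 < r -> (forall n, (N0 <= n)%N -> 0 <= Phi n) ->
  (forall n, (N0 <= n)%N -> `|u n - xb| < r -> `|u n.+1 - u n| <= Phi n - Phi n.+1) ->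
  (forall e N, 0 < e -> exists2 n, (N <= n)%N & `|u n - xb| + Phi n < e) ->
  u @ \oo --> xb /\ (\sum_(0 <= n <oo) `|u n.+1 - u n|%:E < +oo)%E.
Proof.
move=> r0 Phi0 step close.
have trap N m : (N0 <= N)%N -> `|u N - xb| + Phi N < r ->
    `|u (N + m)%N - xb| + Phi (N + m)%N <= `|u N - xb| + Phi N.
  move=> N0N hN; elim: m => [|m ih]; first by rewrite addn0.
  rewrite addnS; have := step (N + m)%N (leq_trans N0N (leq_addr _ _)).
  have hr : `|u (N + m)%N - xb| < r.
    apply: le_lt_trans hN; apply: le_trans ih.
    by rewrite lerDl Phi0// (leq_trans N0N)// leq_addr.
  move=> /(_ hr).
  have := ler_normD (u (N + m).+1 - u (N + m)%N) (u (N + m)%N - xb).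
  rewrite subrKA; lra.
split.
  apply/cvgrPdist_lt => e e0; have := close (Num.min e r) N0.
  rewrite lt_min e0 r0 => /(_ isT)[N N0N]; rewrite lt_min => /andP[hNe hNr].
  exists N => // n /= Nn; rewrite distrC -(subnKC Nn).
  apply: le_lt_trans hNe; apply: le_trans (trap N (n - N)%N N0N hNr).
  by rewrite lerDl Phi0// (leq_trans N0N)// leq_addr.
have [N N0N hN] := close r N0 r0.
pose C := \sum_(0 <= i < N) `|u i.+1 - u i| + Phi N.
have sumle m : \sum_(0 <= i < N + m) `|u i.+1 - u i| <= C - Phi (N + m)%N.
  elim: m => [|m ih]; first by rewrite addn0 /C addrK.
  rewrite addnS big_nat_recr//=; have := step (N + m)%N (leq_trans N0N (leq_addr _ _)).
  have hr : `|u (N + m)%N - xb| < r.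
    apply: le_lt_trans (hN); apply: le_trans (trap N m N0N hN).
    by rewrite lerDl Phi0// (leq_trans N0N)// leq_addr.
  move=> /(_ hr); lra.
apply: (@le_lt_trans _ _ C%:E); last exact: ltry.
apply: lime_le; first by apply: is_cvg_nneseries => *; rewrite lee_fin.
apply: nearW => n; rewrite sumEFin lee_fin.
apply: (@le_trans _ _ (\sum_(0 <= i < N + n) `|u i.+1 - u i|)).
  by rewrite (@big_cat_nat _ _ _ n 0 (N + n))//= ?leq_addl// lerDl sumr_ge0.
by rewrite (le_trans (sumle n))// gerBl Phi0// (leq_trans N0N)// leq_addr.
Qed.

(** The powers beta^k c accumulate only at 0, hence those below B stay at a
    positive distance from B. *)
Lemma geometric_gap (R : realType) (beta c B : R) :
  0 < beta -> beta < 1 -> 0 < c -> 0 < B ->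
  exists2 B' : R, 0 <= B' < B & forall k, beta ^+ k * c < B -> beta ^+ k * c <= B'.
Proof.
move=> b0 b1 c0 B0.
have [K hK] : exists K, forall k, (K <= k)%N -> beta ^+ k * c <= B / 2.
  have : (fun k => beta ^+ k * c) @ \oo --> 0 * c.
    by apply: cvgMl; apply: cvg_expr; rewrite ger0_norm// ltW.
  rewrite mul0r => h; have B20 : 0 < B / 2 by rewrite divr_gt0.
  have [K _ hK] := cvgr_lt _ h _ B20.
  by exists K => k Kk; apply: ltW; exact: hK.
(* Only the finitely many k below K remain; take the largest admissible value. *)
have [B' B'B hB'] : exists2 B' : R, 0 <= B' < B &
    forall k, (k < K)%N -> beta ^+ k * c < B -> beta ^+ k * c <= B'.
  elim: K {hK} => [|K [B' /andP[B'0 B'B] ih]]; first by exists 0 => //; rewrite lexx.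
  have [KB|KB] := ltP (beta ^+ K * c) B.
    exists (Num.max B' (beta ^+ K * c)) => [|k]; first by rewrite le_max B'0/= gt_max B'B.
    rewrite ltnS leq_eqVlt le_max => /orP[/eqP->|kK kB]; first by rewrite lexx orbT.
    by rewrite ih.
  exists B' => [|k]; first by rewrite B'0.
  rewrite ltnS leq_eqVlt => /orP[/eqP-> /(le_lt_trans KB)|]; first by rewrite ltxx.
  exact: ih.
exists (Num.max B' (B / 2)).
  by case/andP: B'B => B'0 B'B; rewrite le_max B'0/= gt_max B'B; lra.
move=> k kB; rewrite le_max; have [kK|Kk] := ltnP k K; first by rewrite hB'.
by rewrite hK ?orbT.
Qed.

(** Converts the KL inequality into a length estimate: x and x' stand for two
    successive step lengths, p for the slope of psi, s for the decrease of the
    merit value and D for the decrease of psi. The hypotheses give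
    x^2 <= (C / c) D (x + x'), and the arithmetic-geometric mean inequality
    x <= (C / c) D + (x + x') / 4 makes the x' term absorbable. *)
Lemma kl_step (R : realType) (c C p x x' D s : R) :
  0 < c -> 0 < C -> 0 < p -> 0 <= x -> 0 <= x' ->
  1 <= p * (C * (x + x')) -> c * x ^+ 2 <= s -> p * s <= D ->
  x <= 2 * (C / c) * D + (x' - x) / 2.
Proof.
move=> c0 C0 p0 x0 x'0 h1 h2 h3.
have pcx : p * (c * x ^+ 2) <= D by apply: le_trans h3; rewrite ler_pM2l.
have D0 : 0 <= D.
  by apply: le_trans pcx; rewrite !mulr_ge0 ?sqr_ge0// ltW.
set K := C / c; have K0 : 0 <= K * D by rewrite mulr_ge0// divr_ge0// ltW.
have key : x ^+ 2 <= (K * D) * (x + x').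
  have b0 : 0 <= C * (x + x') by rewrite mulr_ge0 ?addr_ge0 ?(ltW C0).
  have -> : (K * D) * (x + x') = (D * (C * (x + x'))) / c by rewrite /K; ring.
  rewrite ler_pdivlMr//; apply: le_trans (ler_wpM2r b0 pcx).
  have := ler_wpM2r (mulr_ge0 (ltW c0) (sqr_ge0 x)) h1; lra.
suff : x <= K * D + (x + x') / 4 by lra.
rewrite -ler_sqr ?nnegrE; [|lra|lra].
apply: (le_trans key); have := sqr_ge0 (K * D - (x + x') / 4); lra.
Qed.

Lemma cvg_subseq (T : topologicalType) (v : nat -> T) (l : T) (k : nat -> nat) :
  (forall i, (i <= k i)%N) -> v @ \oo --> l -> v (k i) @[i --> \oo] --> l.
Proof.
move=> hk; apply: cvg_comp => U [N _ hU].
by exists N => // i /= Ni; apply: hU; exact: leq_trans Ni (hk i).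
Qed.

Lemma cvg0_of_norm_le (R : realType) (V : normedModType R) (v : nat -> V) (s : nat -> R) :
  (forall n, `|v n| <= s n) -> s @ \oo --> 0 -> v @ \oo --> 0.
Proof.
move=> hv hs; apply: norm_cvg0; apply: (squeeze_cvgr _ (cvg_cst 0) hs).
by apply: nearW => n; rewrite normr_ge0 hv.
Qed.

(** * One step of the algorithm *)

Section Flow.
Context {R : realType} {X : normedVectType R} (ip : {dot X for idfun}).
Hypothesis hip : forall x : X, `|x| = Num.sqrt (ip x x).
Variables (H : X -> \bar R) (F : X -> R) (f : X -> X) (M : {linear X -> X}).
Variables (L dt alpha beta lmax : R).
Hypotheses (Hproper : eproper H) (Hconvex : econvex H).
Hypothesis Fgrad : forall x, is_gradient ip F x (f x).
Hypothesis L_gt0 : 0 < L.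
Hypothesis f_lipschitz : forall x y, `|f x - f y| <= L * `|x - y|.
Hypothesis E_level_bounded : level_bounded (energy H F).
Hypothesis M_selfadjoint : forall x y, ip (M x) y = ip x (M y).
Hypothesis M_psd : forall x, 0 <= ip (M x) x.
Hypotheses (dt_gt0 : 0 < dt) (dt_lt : dt < 2 / (3 * L)).
Hypotheses (alpha_gt0 : 0 < alpha) (beta_gt0 : 0 < beta) (beta_lt1 : beta < 1).
Hypothesis lmax_gt0 : 0 < lmax.
Local Notation E := (energy H F).
Local Notation A := (Atilde ip H F M L dt).

Let dt_neq0 : dt != 0. Proof. by rewrite gt_eqF. Qed.

(** The coefficient of the squared norm in the merit function. *)
Definition gap_coef := 5 / (3 * dt) - L.

(** In this part v is the current iterate, w the previous one and y the proximal
    point. This is the element of the subdifferential of H at y given by the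
    first-order optimality condition of the proximal step. *)
Definition prox_subgrad (v w y : X) : X :=
  (2 / (3 * dt)) *: (v - w) - f v - (f v - f w)
  - (2 / dt) *: (y - v) - M (y - extrapolation v w).

Definition energy_subgrad v w y := prox_subgrad v w y + f y.

Lemma subr_extrapolation (v w y : X) :
  y - extrapolation v w = (y - v) - (1 / 3) *: (v - w).
Proof.
rewrite /extrapolation; have -> : (4 / 3 : R) = 1 + 1 / 3 by field.
by rewrite scalerDl scale1r scalerBr -(addrA v) opprD addrA.
Qed.

Lemma M_swap x z : ip (M x) z = ip (M z) x.
Proof. by rewrite M_selfadjoint ipC. Qed.

Lemma quadratic_lower (x z : X) : F x + ip (f x) (z - x) - L / 2 * `|z - x| ^+ 2 <= F z.
Proof.
have := descent_lemma hip Fgrad f_lipschitz x (z - x).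
rewrite [x + _]addrC subrK ler_norml => /andP[]; lra.
Qed.

Lemma quadratic_upper (x z : X) : F z <= F x + ip (f x) (z - x) + L / 2 * `|z - x| ^+ 2.
Proof.
have := descent_lemma hip Fgrad f_lipschitz x (z - x).
rewrite [x + _]addrC subrK ler_norml => /andP[]; lra.
Qed.

Lemma Fn_gradient (v w g : X) : is_gradient ip (Fn ip F f dt v w) v g ->
  g = (2 / (3 * dt)) *: (v - w) - f v - (f v - f w).
Proof.
move=> gg; apply: (is_gradient_unique hip (K := 1 / (3 * dt) + L / 2) gg) => k.
rewrite /Fn; have -> : v + k - w = k + (v - w) by rewrite addrAC addrC.
have := descent_lemma hip Fgrad f_lipschitz v k.
set D := F _ - F v - _ => hD.
have -> : 1 / (3 * dt) * `|k + (v - w)| ^+ 2 - F (v + k) - ip (f v - f w) (k + (v - w)) -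
   (1 / (3 * dt) * `|v - w| ^+ 2 - F v - ip (f v - f w) (v - w)) -
   ip ((2 / (3 * dt)) *: (v - w) - f v - (f v - f w)) k =
   1 / (3 * dt) * `|k| ^+ 2 - D.
  rewrite /D -!(ipxx hip) !ipE (ipC _ k v) (ipC _ k w) (ipC _ w v); field; exact: dt_neq0.
rewrite (le_trans (ler_normB _ _))// [leRHS]mulrDl lerD//.
by rewrite ger0_norm// mulr_ge0// divr_ge0// mulr_ge0// ltW.
Qed.

Lemma prox_step_fin (v w y : X) : prox_step ip H F f M dt v w y -> H y \is a fin_num.
Proof.
move=> [g _ ymin]; have [Hno [x0 Hx0]] := Hproper.
rewrite fin_numE Hno/=; apply/eqP => Hy.
have := ymin x0; rewrite /Hn Hy; move: (Hno x0) Hx0; case: (H x0) => //.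
Qed.

Lemma sqnormMZ (t : R) (k : X) : sqnormM ip M (t *: k) = t ^+ 2 * sqnormM ip M k.
Proof.
have MZ : M (t *: k) = t *: M k by exact: linearZ.
by rewrite /sqnormM MZ ipZl ipZr; ring.
Qed.

Lemma prox_model_expand (v x g y k : X) :
  1 / dt * `|y + k - v| ^+ 2 + (- ip g (y + k) + 1 / 2 * sqnormM ip M (y + k - x)) =
  1 / dt * `|y - v| ^+ 2 + (- ip g y + 1 / 2 * sqnormM ip M (y - x))
  - ip (g - (2 / dt) *: (y - v) - M (y - x)) k
  + (1 / dt * `|k| ^+ 2 + 1 / 2 * sqnormM ip M k).
Proof.
rewrite (addrAC y k) (addrAC y k) /sqnormM.
have -> : ip g (y + k) = ip g y + ip g k by rewrite ipDr.
move: (y - v) (y - x) => a b.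
rewrite -!(ipxx hip) !linearD /= !ipE.
rewrite (M_swap k b) (ipC _ k a); field; exact: dt_neq0.
Qed.

(** Compare y with y + t (z - y): convexity of H bounds H there by a chord and the
    quadratic model changes by a linear term plus t^2 B, so dividing by t and
    letting t tend to 0 gives the inequality. *)
Lemma prox_subgradP (v w y : X) : prox_step ip H F f M dt v w y ->
  forall z, (H y + (ip (prox_subgrad v w y) (z - y))%:E <= H z)%E.
Proof.
move=> st z; have Hy := prox_step_fin st; have [Hno _] := Hproper.
case: st => g /Fn_gradient gE ymin.
move: (Hno z) (@Hconvex z y); case Hz : (H z) => [r| |]// _ cvx; last by rewrite leey.
rewrite -(fineK Hy) -EFinD lee_fin; set h := fine (H y).
pose B := 1 / dt * `|z - y| ^+ 2 + 1 / 2 * sqnormM ip M (z - y).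
have B0 : 0 <= B.
  apply: addr_ge0; apply: mulr_ge0; [|exact: sqr_ge0|lra|exact: M_psd].
  by rewrite divr_ge0// ltW.
suff : ip (prox_subgrad v w y) (z - y) - (r - h) <= 0 by lra.
apply: (le0_of_small_multiples B0) => t t01.
have := ymin (t *: z + (1 - t) *: y); have := cvx t t01.
rewrite /Hn -(fineK Hy) -/h -!EFinM -EFinD.
move: (Hno (t *: z + (1 - t) *: y)); case: (H _) => [s| |]// _.
rewrite !lee_fin => h1 h2.
have [t0 t1] := andP t01.
rewrite -(ler_pM2l t0).
have e : t *: z + (1 - t) *: y = y + t *: (z - y).
  by rewrite scalerBl scale1r scalerBr addrCA.
rewrite e in h2; have := prox_model_expand v (extrapolation v w) g y (t *: (z - y)).
have -> : prox_subgrad v w y =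
  g - (2 / dt) *: (y - v) - M (y - extrapolation v w) by rewrite gE.
rewrite [`|t *: (z - y)|]normrZ exprMn real_normK ?num_real// sqnormMZ ipZr /B; lra.
Qed.

Lemma energy_no x : E x != -oo%E.
Proof. by have [Hno _] := Hproper; move: (Hno x); rewrite /energy; case: (H x). Qed.

Lemma energy_fin x : (E x \is a fin_num) = (H x \is a fin_num).
Proof. by rewrite /energy; case: (H x). Qed.

Lemma energy_subgradP (v w y : X) : prox_step ip H F f M dt v w y ->
  forall z, (E y + (ip (energy_subgrad v w y) (z - y) - L / 2 * `|z - y| ^+ 2)%:E <= E z)%E.
Proof.
move=> st z; have := prox_subgradP st z; have Hy := prox_step_fin st.
have [Hno _] := Hproper.
rewrite /energy -(fineK Hy); move: (Hno z); case: (H z) => [r| |]// _;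
  last by move=> _; exact: leey.
rewrite -!EFinD !lee_fin /energy_subgrad [ip (_ + f y) _]ipDl; have := quadratic_lower y z; lra.
Qed.

Lemma gap_coef_gt0 : 0 < gap_coef.
Proof.
rewrite /gap_coef subr_gt0 ltr_pdivlMr ?mulr_gt0//.
by move: dt_lt; rewrite ltr_pdivlMr ?mulr_gt0//; lra.
Qed.

(** The part of the merit function that depends on the difference of its two
    arguments only. *)
Definition gap (d : X) : R := gap_coef * `|d| ^+ 2 + 5 / 6 * sqnormM ip M d.

Lemma gap_ge0 d : 0 <= gap d.
Proof. by rewrite addr_ge0// mulr_ge0 ?sqr_ge0 ?(ltW gap_coef_gt0)//; exact: M_psd. Qed.

Lemma AtildeE x y : A (x, y) = (E y + (gap (y - x))%:E)%E.
Proof. by []. Qed.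

Lemma Atilde_diag z : A (z, z) = E z.
Proof.
by rewrite AtildeE subrr /gap normr0 expr0n mulr0 add0r /sqnormM linear0r mulr0 adde0.
Qed.

Lemma gapD d e : gap (d + e) =
  gap d + (2 * gap_coef * ip d e + 5 / 3 * ip (M d) e) + gap e.
Proof.
have MD : M (d + e) = M d + M e by exact: linearD.
rewrite /gap /sqnormM -!(ipxx hip) MD !ipE (M_swap e d) (ipC _ e d).
by field.
Qed.

Definition gap_grad (d : X) : X := (2 * gap_coef) *: d + (5 / 3) *: M d.

Definition Atilde_subgrad v w y : X * X :=
  (- gap_grad (y - v), energy_subgrad v w y + gap_grad (y - v)).

Lemma hnorm_prod (p : X * X) : hnorm (prod_ip ip) p ^+ 2 = `|p.1| ^+ 2 + `|p.2| ^+ 2.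
Proof. by rewrite /hnorm sqr_sqrtr /prod_ip !(ipxx hip)// addr_ge0// sqr_ge0. Qed.

Lemma hnorm_prod_le (p : X * X) : hnorm (prod_ip ip) p <= `|p.1| + `|p.2|.
Proof.
rewrite -ler_sqr ?nnegrE ?sqrtr_ge0 ?addr_ge0// hnorm_prod sqrrD.
by rewrite lerD2r lerDl mulrn_wge0// mulr_ge0.
Qed.

(** Writing z2 - z1 = (y - v) + e, the quadratic gap lies above its tangent at
    y - v, and E above the quadratic minorant of energy_subgradP. *)
Lemma Atilde_subgradP (v w y : X) : prox_step ip H F f M dt v w y ->
  frechet_subdiff (prod_ip ip) A (v, y) (Atilde_subgrad v w y).
Proof.
move=> st; have Hy := prox_step_fin st; apply: (frechet_of_quadratic (K := L / 2)).
- by rewrite AtildeE fin_numD/= energy_fin Hy.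
- move=> e e0; apply/nbhs_ballP; exists (e / 2) => [/=|]; first by rewrite divr_gt0.
  move=> [z1 z2] [/=]; rewrite -!ball_normE /= !(distrC _ z1) !(distrC _ z2) => h1 h2.
  by rewrite (le_trans (hnorm_prod_le _))//=; lra.
- move=> [z1 z2]; rewrite hnorm_prod !AtildeE /prod_ip /=.
  have := energy_subgradP st z2.
  move: (energy_no z2); case: (E z2) => [r| |]// _; last by rewrite !leey.
  have Ey : E y \is a fin_num by rewrite energy_fin.
  rewrite -(fineK Ey) -!EFinD !lee_fin.
  have -> : z2 - z1 = (y - v) + ((z2 - y) - (z1 - v)).
    by rewrite opprB addrA (addrC (y - v)) !subrKA.
  rewrite (gapD (y - v)); have := gap_ge0 (z2 - y - (z1 - v)).
  have := mulr_ge0 (ltW L_gt0) (sqr_ge0 `|z1 - v|).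
  rewrite [ip (- _) _]ipNl [ip (_ + gap_grad _) _]ipDl /gap_grad.
  move: (energy_subgrad v w y) => b.
  move: (z2 - y) (z1 - v) (y - v) => k2 k1 d; rewrite !ipE; lra.
Qed.

Lemma energy_frechet (v w y : X) : prox_step ip H F f M dt v w y ->
  frechet_subdiff ip E y (energy_subgrad v w y).
Proof.
move=> st; have Hy := prox_step_fin st; apply: (frechet_of_quadratic (K := L / 2)).
- by rewrite energy_fin.
- move=> e e0; apply/nbhs_ballP; exists e => //= z; rewrite -ball_normE /= distrC.
  by rewrite /hnorm -hip => /ltW.
- by move=> z; have := energy_subgradP st z; rewrite /hnorm -hip.
Qed.

(** Test the subgradient inequality at v. The cross terms in p = v - w and
    d = y - v come from the delayed gradient and from the extrapolation; splitting
    them evenly by Young's inequality leaves only terms in p besides E v, and the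
    terms in d add up to the gap. *)
Lemma one_step (v w y : X) : prox_step ip H F f M dt v w y ->
  (A (v, y) <= E v + ((L / 2 + 1 / (3 * dt)) * `|v - w| ^+ 2
                      + 1 / 6 * sqnormM ip M (v - w))%:E)%E.
Proof.
move=> st; have := prox_subgradP st v; have Hy := prox_step_fin st.
have [Hno _] := Hproper.
rewrite AtildeE /energy -(fineK Hy); move: (Hno v); case: (H v) => [r| |]// _;
  last by move=> _; exact: leey.
rewrite -!EFinD !lee_fin /gap /gap_coef.
have dd := quadratic_upper v y.
have -> : v - y = - (y - v) by rewrite opprB.
rewrite /prox_subgrad subr_extrapolation; move: dd.
have fL : - ip (f v - f w) (y - v) <= L / 2 * (`|v - w| ^+ 2 + `|y - v| ^+ 2).
  rewrite -ipNl (le_trans (ip_le hip _ _))// normrN.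
  apply: (@le_trans _ _ (L * `|v - w| * `|y - v|)); first by rewrite ler_wpM2r.
  rewrite -subr_ge0.
  have := mulr_ge0 (ltW L_gt0) (sqr_ge0 (`|v - w| - `|y - v|)); lra.
move: fL; move: (f v - f w) => fvw.
move: (v - w) (y - v) => p d fL dd.
have pd : 2 * ip p d <= `|p| ^+ 2 + `|d| ^+ 2.
  have := ip_ge0 ip (p - d); rewrite -!(ipxx hip) !ipE (ipC _ d p); lra.
have Mpd : 2 * ip (M p) d <= sqnormM ip M p + sqnormM ip M d.
  have MB : M (p - d) = M p - M d by exact: linearB.
  have := M_psd (p - d); rewrite MB !ipE (M_swap d p) /sqnormM; lra.
have {pd} : 1 / (3 * dt) * (2 * ip p d) <= 1 / (3 * dt) * (`|p| ^+ 2 + `|d| ^+ 2).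
  by rewrite ler_wpM2l// divr_ge0// mulr_ge0// ltW.
have -> : M (d - (1 / 3) *: p) = M d - (1 / 3) *: M p.
  by rewrite linearB; congr (_ - _); exact: linearZ.
rewrite !ipE (ipxx hip).
have -> : 2 / (3 * dt) = 1 / (3 * dt) * 2 by field; exact: dt_neq0.
have -> : 5 / (3 * dt) = 1 / (3 * dt) * 5 by field; exact: dt_neq0.
have -> : 2 / dt = 1 / (3 * dt) * 6 by field; exact: dt_neq0.
move: (1 / (3 * dt)) dd fL Mpd => c.
rewrite /sqnormM; lra.
Qed.

Lemma energy_subgrad_norm (K : R) (v w y : X) :
  0 <= K -> (forall x, `|M x| <= K * `|x|) ->
  `|energy_subgrad v w y| <= (2 / dt + L + K) * (`|v - w| + `|y - v|).
Proof.
move=> K0 hM.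
have -> : energy_subgrad v w y = (2 / (3 * dt)) *: (v - w) + (f y - f v) - (f v - f w)
  - (2 / dt) *: (y - v) - M (y - extrapolation v w).
  rewrite /energy_subgrad /prox_subgrad.
  by rewrite [LHS]addrAC; congr (_ - _); rewrite [LHS]addrAC; congr (_ - _);
     rewrite [LHS]addrAC; congr (_ - _); rewrite addrAC -addrA.
rewrite subr_extrapolation.
have h1 := f_lipschitz y v; have h2 := f_lipschitz v w.
have h3 := le_trans (hM _) (ler_wpM2l K0 (ler_normB (y - v) ((1 / 3) *: (v - w)))).
rewrite (le_trans (ler_normB _ _))// (le_trans (lerD (ler_normB _ _) h3))//.
rewrite (le_trans (lerD (lerD (ler_normB _ _) (lexx _)) (lexx _)))//.
rewrite (le_trans (lerD (lerD (lerD (ler_normD _ _) (lexx _)) (lexx _)) (lexx _)))//.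
rewrite !normrZ !ger0_norm ?divr_ge0 ?mulr_ge0 ?invr_ge0 ?mulr_ge0 ?(ltW dt_gt0)//.
have -> : 2 / (3 * dt) = 1 / 3 * (2 / dt) by field; exact: dt_neq0.
have c0 : 0 <= 2 / dt by rewrite divr_ge0// ltW.
have := mulr_ge0 c0 (normr_ge0 (v - w)); have := mulr_ge0 K0 (normr_ge0 (v - w)).
lra.
Qed.

Lemma gap_grad_norm (K : R) (d : X) : (forall x, `|M x| <= K * `|x|) ->
  `|gap_grad d| <= (2 * gap_coef + 5 / 3 * K) * `|d|.
Proof.
move=> hM; rewrite /gap_grad (le_trans (ler_normD _ _))// !normrZ mulrDl lerD//.
  by rewrite !(@ger0_norm R) ?(ltW gap_coef_gt0).
by rewrite !(@ger0_norm R)// -[leRHS]mulrA ler_wpM2l.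
Qed.

Lemma Atilde_subgrad_norm (K : R) (v w y : X) :
  0 <= K -> (forall x, `|M x| <= K * `|x|) ->
  hnorm (prod_ip ip) (Atilde_subgrad v w y) <=
  (2 / dt + L + K + 2 * (2 * gap_coef + 5 / 3 * K)) * (`|v - w| + `|y - v|).
Proof.
move=> K0 hM; rewrite (le_trans (hnorm_prod_le _))//= normrN.
have h1 := energy_subgrad_norm v w y K0 hM.
have h2 := gap_grad_norm (y - v) hM.
have h3 := ler_normD (energy_subgrad v w y) (gap_grad (y - v)).
have c0 : 0 <= 2 * gap_coef + 5 / 3 * K.
  by rewrite addr_ge0// mulr_ge0// ltW// gap_coef_gt0.
have := mulr_ge0 c0 (normr_ge0 (v - w)); lra.
Qed.

(** * Decrease of the merit function along a run *)

Hypothesis A_KL : KL_function (prod_ip ip) A.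
Let A_lsc : lower_semicontinuous A. Proof. by case: A_KL. Qed.
Variables (u y : nat -> X) (lam : nat -> R).
Hypothesis run : FlowBBApe_NLS ip H F f M dt alpha beta lmax u y lam.
Hypothesis lam_bound : forall n, 0 <= lam n <
       Num.min (Num.sqrt ((10 - 6 * dt * L) / (2 + 3 * dt * L)) - 1)
               (Num.sqrt 5 - 1).

Let len n := `|y n - u n|.
Let merit n := fine (A (u n, y n)).
Let prox n : prox_step ip H F f M dt (u n) (u n.-1) (y n).
Proof. by case: (run n). Qed.

Lemma len_gt0 n : 0 < len n.
Proof. by rewrite /len normr_gt0; case: (run n). Qed.

Lemma Ey_fin n : E (y n) \is a fin_num.
Proof. by rewrite energy_fin; exact: prox_step_fin (prox n). Qed.

Lemma A_fin n : A (u n, y n) \is a fin_num.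
Proof. by rewrite AtildeE fin_numD/= Ey_fin. Qed.

Lemma AmeritE n : A (u n, y n) = (merit n)%:E.
Proof. by rewrite fineK// A_fin. Qed.

Lemma merit_gap n : merit n = fine (E (y n)) + gap (y n - u n).
Proof. by rewrite /merit AtildeE -{1}(fineK (Ey_fin n)) -EFinD. Qed.

Lemma Ey_le n : (E (y n) <= (merit n)%:E)%E.
Proof. by rewrite -AmeritE AtildeE leeDl// lee_fin gap_ge0. Qed.

Lemma next_iterate n : u n.+1 - u n = (1 + lam n) *: (y n - u n).
Proof.
have [_ _ [[_ [-> ->]]|[_ [_ ->]]]] := run n; first by rewrite addr0 scale1r.
by rewrite scalerDl scale1r addrAC.
Qed.

Lemma next_energy n : (E (u n.+1) <= E (y n))%E.
Proof.
have [_ _ [[_ [_ ->]]//|[_ [[k [_ nrej _]] ->]]]] := run n.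
move/negP: nrej; rewrite -leNgt => /le_trans; apply.
rewrite leeBlDr// leeDl// lee_fin !mulr_ge0 ?sqr_ge0 ?(ltW alpha_gt0)//.
by case/andP: (lam_bound n).
Qed.

Let kappa := L / 2 + 1 / (3 * dt).

(** Uniform form of the bound on the steps: lam n is 0 or some beta^k lmax, so
    geometric_gap applies. The two inequalities on rho are the positivity of the
    decrease in the squared norm and in the M-seminorm. *)
Lemma step_ratio : exists rho : R, [/\ rho < 5, 0 < gap_coef - kappa * rho &
  forall n, (1 + lam n) ^+ 2 <= rho].
Proof.
set s1 := Num.sqrt ((10 - 6 * dt * L) / (2 + 3 * dt * L)); set s2 := Num.sqrt (5 : R).
pose B := Num.min (s1 - 1) (s2 - 1).
have B0 : 0 < B by case/andP: (lam_bound 0) => /le_lt_trans h /h.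
have [B' /andP[B'0 B'B] hB'] := geometric_gap beta_gt0 beta_lt1 lmax_gt0 B0.
have lamB' n : lam n <= B'.
  have [_ _ [[_ [-> _]]//|[_ [[k [lamE _ _]] _]]]] := run n.
  by rewrite lamE; apply: hB'; rewrite -lamE; case/andP: (lam_bound n).
exists ((1 + B') ^+ 2).
move: B'B; rewrite lt_min => /andP[B1 B2].
have Ldt : 0 < dt * L by rewrite mulr_gt0.
have Ldt1 : 3 * (dt * L) < 2 by move: dt_lt; rewrite ltr_pdivlMr ?mulr_gt0//; lra.
split.
- have -> : 5 = s2 ^+ 2 by rewrite sqr_sqrtr.
  by rewrite ltr_sqr ?nnegrE ?sqrtr_ge0; lra.
- have : (1 + B') ^+ 2 < s1 ^+ 2 by rewrite ltr_sqr ?nnegrE ?sqrtr_ge0//; lra.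
  rewrite sqr_sqrtr; last by rewrite divr_ge0; lra.
  rewrite ltr_pdivlMr; last lra.
  have -> : gap_coef - kappa * (1 + B') ^+ 2 =
    (10 - 6 * dt * L - (1 + B') ^+ 2 * (2 + 3 * dt * L)) / (6 * dt).
    by rewrite /gap_coef /kappa; field; rewrite gt_eqF.
  by move=> h; rewrite divr_gt0 ?mulr_gt0// subr_gt0.
- move=> n; case/andP: (lam_bound n) => l0 _; have := lamB' n => l1.
  by rewrite ler_sqr ?nnegrE; lra.
Qed.

Lemma lam_le n : 1 + lam n <= 3.
Proof.
have [rho [r5 _ /(_ n) h]] := step_ratio.
case/andP: (lam_bound n) => l0 _.
by rewrite -ler_sqr ?nnegrE; lra.
Qed.

Lemma step_le n : `|u n.+1 - u n| <= 3 * len n.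
Proof.
rewrite next_iterate normrZ ger0_norm; last by case/andP: (lam_bound n); lra.
by rewrite ler_wpM2r// lam_le.
Qed.

(** At n = 0 the previous iterate is u 0 itself, so the left side is 0. *)
Lemma back_step_le n : `|u n - u n.-1| <= 3 * len n.-1.
Proof.
case: n => [|n] /=; last exact: step_le.
by rewrite subrr normr0 mulr_ge0// ltW// len_gt0.
Qed.

Lemma sufficient_decrease : exists2 c : R, 0 < c & forall n, merit n.+1 <= merit n - c * len n ^+ 2.
Proof.
have [rho [r5 c0 hrho]] := step_ratio.
exists (gap_coef - kappa * rho) => // n.
have := one_step (prox n.+1).
rewrite AmeritE /= -/kappa => h.
have := le_trans h (leeD2r _ (next_energy n)).
rewrite -(fineK (Ey_fin n)) -EFinD lee_fin next_iterate normrZ exprMn.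
rewrite real_normK ?num_real// sqnormMZ -/(len n).
have -> : fine (E (y n)) = merit n - gap (y n - u n).
  by rewrite merit_gap addrK.
rewrite /gap -/(len n); set S := sqnormM _ _ _.
have S0 : 0 <= S by exact: M_psd.
have k0 : 0 <= kappa * len n ^+ 2.
  by rewrite mulr_ge0 ?sqr_ge0// addr_ge0// divr_ge0 ?mulr_ge0// ltW.
have := ler_wpM2r k0 (hrho n); have := ler_wpM2r S0 (hrho n).
have r5S : rho * S <= 5 * S by rewrite ler_wpM2r// ltW.
lra.
Qed.

Lemma merit_decr n : merit n.+1 < merit n.
Proof.
have [c c0 h] := sufficient_decrease; have := h n.
have : 0 < c * len n ^+ 2 by rewrite mulr_gt0// exprn_gt0// len_gt0.
lra.
Qed.

Lemma A_decreasing : decreasing_seq (fun n => A (u n, y n)).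
Proof.
suff h : decreasing_seq merit by move=> n m; rewrite !AmeritE -h.
by apply/decreasing_seqP => n; exact: merit_decr.
Qed.

Lemma merit_le0 n : merit n <= merit 0%N.
Proof. by elim: n => // n; apply: le_trans; exact: ltW (merit_decr n). Qed.

Lemma level_bound : exists C : R, forall x, (E x <= (merit 0%N)%:E)%E -> `|x| <= C.
Proof.
have [C0 [_ hC]] := E_level_bounded (merit 0%N).
by exists (C0 + 1) => x Ex; apply: (hC (C0 + 1)) => //; rewrite ltrDl.
Qed.

Lemma y_bounded : exists C : R, forall n, `|y n| <= C.
Proof.
have [C hC] := level_bound; exists C => n; apply: hC.
by rewrite (le_trans (Ey_le n))// lee_fin merit_le0.
Qed.

Lemma u_bounded : exists C : R, forall n, `|u n| <= C.
Proof.
have [C hC] := level_bound; exists (Num.max C `|u 0%N|) => -[|n].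
  by rewrite le_max lexx orbT.
rewrite le_max hC// (le_trans (next_energy n))// (le_trans (Ey_le n))//.
by rewrite lee_fin merit_le0.
Qed.

(** Inherited from the merit function, which coincides with E on the
    diagonal. *)
Lemma energy_lsc : lower_semicontinuous E.
Proof.
move=> x m; rewrite -Atilde_diag => /A_lsc [V nV hV].
exists [set z | V (z, z)]; last by move=> z /hV; rewrite Atilde_diag.
have : (fun z : X => (z, z)) @ x --> (x, x) by apply: cvg_pair; exact: cvg_id.
exact.
Qed.

(** Nonincreasing values which stay above some m < E x along a subsequence of
    proximal points converging to x stay above m throughout. *)
Lemma merit_lbound : exists m : R, forall n, m <= merit n.
Proof.
have [C hC] := y_bounded.
have [x [k [hk yk]]] := bounded_seq_cluster hC.
have [m mE] : exists m : R, (m%:E < E x)%E.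
  have := energy_no x; case: (E x) => [r| |]// _; last by exists 0; rewrite ltry.
  by exists (r - 1); rewrite lte_fin; lra.
have [V nV hV] := energy_lsc mE.
have [N _ hN] := yk _ nV.
exists m => n; have := hV _ (hN (maxn n N) (leq_maxr _ _)) => /=.
have ka : merit (k (maxn n N)) <= merit n.
  have /decreasing_seqP h := merit_decr.
  by rewrite h (leq_trans (leq_maxl _ _) (hk _)).
move=> /lt_le_trans /(_ (Ey_le _)); rewrite lte_fin => /ltW h; exact: le_trans h ka.
Qed.

Lemma merit_cvg : exists2 zeta : R, merit @ \oo --> zeta & forall n, zeta < merit n.
Proof.
have [m hm] := merit_lbound.
have /decreasing_seqP dec := merit_decr.
have ni : nonincreasing_seq merit by move=> i j; rewrite dec.
have cv : cvgn merit by apply: nonincreasing_is_cvgn => //; exists m => _ [n _ <-].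
exists (limn merit) => // n; apply: le_lt_trans (merit_decr n).
exact: nonincreasing_cvgn_ge.
Qed.

Lemma len_cvg0 : len @ \oo --> 0.
Proof.
have [c c0 hc] := sufficient_decrease; have [z merit_zeta hz] := merit_cvg.
have d2 : (fun n => c^-1 * (merit n - merit n.+1)) @ \oo --> 0.
  rewrite -(mulr0 c^-1); apply: cvgMr; rewrite -(subrr z); apply: cvgB => //.
  by rewrite (cvg_shiftS merit).
apply/cvgrPdist_lt => e e0; have e20 : 0 < e ^+ 2 by rewrite exprn_gt0.
have [N _ hN] := cvgr_lt _ d2 _ e20.
exists N => // n /hN /= h; rewrite sub0r normrN ger0_norm ?ltW ?len_gt0//.
rewrite -ltr_sqr ?nnegrE ?ltW ?len_gt0//; apply: le_lt_trans h.
by rewrite ler_pdivlMl//; have := hc n; lra.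
Qed.

Lemma len_pred_cvg0 : (fun n => len n.-1) @ \oo --> 0.
Proof. by rewrite -(cvg_shiftS (fun n => len n.-1)) /=; exact: len_cvg0. Qed.

Lemma M_bounded : exists2 K : R, 0 <= K & forall x, `|M x| <= K * `|x|.
Proof. by have [K K0 hK] := linear_findim_bounded M; exists K => //; exact: ltW. Qed.

(** * Vanishing subgradients *)

Let Aslope n := Atilde_subgrad (u n) (u n.-1) (y n).

Lemma Aslope_norm : exists2 C : R, 0 < C &
  forall n, hnorm (prod_ip ip) (Aslope n) <= C * (len n + len n.-1).
Proof.
have [K K0 hK] := M_bounded.
set C := 2 / dt + L + K + 2 * (2 * gap_coef + 5 / 3 * K).
have C0 : 0 < C.
  have g0 := gap_coef_gt0.
  have c2 : 0 < 2 / dt by rewrite divr_gt0.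
  by move: K0 L_gt0; rewrite /C; lra.
exists (3 * C) => [|n]; first by rewrite mulr_gt0.
rewrite (le_trans (Atilde_subgrad_norm _ _ _ K0 hK))//.
rewrite -/C (mulrC 3) -mulrA ler_wpM2l ?(ltW C0)//.
have := back_step_le n; have := len_gt0 n; rewrite -/(len n); lra.
Qed.

Let Eslope n := energy_subgrad (u n) (u n.-1) (y n).

Lemma Eslope_norm : exists2 C : R, 0 < C & forall n, `|Eslope n| <= C * (len n + len n.-1).
Proof.
have [K K0 hK] := M_bounded.
set C := 2 / dt + L + K.
have C0 : 0 < C.
  have c2 : 0 < 2 / dt by rewrite divr_gt0.
  by move: K0 L_gt0; rewrite /C; lra.
exists (3 * C) => [|n]; first by rewrite mulr_gt0.
rewrite (le_trans (energy_subgrad_norm _ _ _ K0 hK))//.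
rewrite -/C (mulrC 3) -mulrA ler_wpM2l ?(ltW C0)//.
have := back_step_le n; have := len_gt0 n; rewrite -/(len n); lra.
Qed.

Lemma len_sum_cvg0 C : (fun n => C * (len n + len n.-1)) @ \oo --> 0.
Proof.
rewrite -(mulr0 C) -(addr0 0); apply: cvgMr; apply: cvgD; [exact: len_cvg0|exact: len_pred_cvg0].
Qed.

Lemma dist0_le_Aslope n :
  (dist0 (prod_ip ip) (subdiff (prod_ip ip) A (u n, y n)) <=
   (hnorm (prod_ip ip) (Aslope n))%:E)%E.
Proof. exact: dist0_le (frechet_subdiffW (Atilde_subgradP (prox n))). Qed.

Lemma dist0_cvg0 :
  dist0 (prod_ip ip) (subdiff (prod_ip ip) A (u n, y n)) @[n --> \oo] --> 0%:E.
Proof.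
have [C C0 hC] := Aslope_norm.
apply: (@squeeze_cvge _ _ _ _ (fun=> 0%:E) _ (fun n => (C * (len n + len n.-1))%:E));
  last 2 first.
- exact: cvg_cst.
- by apply: cvg_EFin; [exact: nearW|exact: len_sum_cvg0].
apply: nearW => n; rewrite dist0_ge0/=.
by apply: (le_trans (dist0_le_Aslope n)); rewrite lee_fin.
Qed.

(** * Cluster points are critical *)

Section Cluster.
Variables (xb : X) (k : nat -> nat) (zeta : R).
Hypotheses (hk : forall i, (i <= k i)%N) (uk : u (k i) @[i --> \oo] --> xb).
Hypotheses (merit_zeta : merit @ \oo --> zeta) (zeta_lt : forall n, zeta < merit n).

Lemma y_sub : y (k i) @[i --> \oo] --> xb.
Proof.
have -> : (fun i => y (k i)) = (fun i => u (k i) + (y (k i) - u (k i))).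
  by apply/funext => i; rewrite addrC subrK.
rewrite -[X in _ --> X]addr0; apply: cvgD => //.
by apply: (cvg0_of_norm_le (s := fun i => len (k i))) => //; exact: cvg_subseq len_cvg0.
Qed.

(** Lower semicontinuity gives one inequality. For the other, the minorant of
    energy_subgradP centered at y (k i) and evaluated at xb shows that the merit
    values along k exceed E xb by a vanishing amount at most. *)
Lemma energy_limit : E xb = zeta%:E.
Proof.
have le1 : (E xb <= zeta%:E)%E.
  rewrite leNgt; apply/negP => zE.
  have [m zm mE] : exists2 m, zeta < m & (m%:E < E xb)%E.
    move: (energy_no xb) zE; case: (E xb) => [r| |]// _.
      by rewrite lte_fin => zr; exists ((zeta + r) / 2); rewrite ?lte_fin; lra.
    by exists (zeta + 1); rewrite ?ltry//; lra.
  have [V nV hV] := energy_lsc mE.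
  have [N _ hN] := y_sub nV; have [N' _ hN'] := cvgr_lt _ (cvg_subseq hk merit_zeta) _ zm.
  have h1 := hV _ (hN (maxn N N') (leq_maxl _ _)).
  have := hN' (maxn N N') (leq_maxr _ _); rewrite /= => h2.
  have := lt_le_trans h1 (Ey_le _); rewrite lte_fin => h3.
  by have := lt_trans h2 h3; rewrite ltxx.
apply/eqP; rewrite eq_le le1 /=.
move: (energy_no xb) le1; case Exb : (E xb) => [r| |]// _ _.
rewrite lee_fin; have [K K0 hK] := M_bounded; have [C C0 hC] := Eslope_norm.
pose s i := `|xb - y (k i)|.
have s0 : s @ \oo --> 0.
  by rewrite -(normr0 X) -(subrr xb); apply: cvg_norm; apply: cvgB y_sub; exact: cvg_cst.
have dk : (fun i => len (k i)) @ \oo --> 0 by exact: cvg_subseq len_cvg0.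
pose g i := r + (gap_coef + 5 / 6 * K) * (len (k i) * len (k i))
  + (C * (len (k i) + len (k i).-1)) * s i + L / 2 * (s i * s i).
have g0 : g @ \oo --> r.
  have -> : r = r + (gap_coef + 5 / 6 * K) * (0 * 0) + 0 * 0 + L / 2 * (0 * 0) by ring.
  apply: cvgD; [apply: cvgD; [apply: cvgD; [exact: cvg_cst|]|]|].
  - by apply: cvgMr; apply: cvgM.
  - by apply: cvgM => //; exact: cvg_subseq (len_sum_cvg0 C).
  - by apply: cvgMr; apply: cvgM.
apply: (ler_cvg_to (cvg_subseq hk merit_zeta) g0); apply: nearW => i /=.
have := energy_subgradP (prox (k i)) xb.
rewrite Exb -(fineK (Ey_fin _)) -EFinD lee_fin -/(Eslope (k i)) -/(s i) => h.
rewrite merit_gap /g.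
have := cauchy_schwarz hip (Eslope (k i)) (xb - y (k i)); rewrite ler_norml -/(s i) => /andP[h1 _].
have si0 : 0 <= s i by rewrite /s.
have h2 := ler_wpM2r si0 (hC (k i)).
have h3 : sqnormM ip M (y (k i) - u (k i)) <= K * (len (k i) * len (k i)).
  by rewrite (le_trans (ip_le hip _ _))// mulrA ler_wpM2r// hK.
rewrite /gap -/(len (k i)) expr2; rewrite expr2 in h; lra.
Qed.

Lemma critical_Atilde : subdiff (prod_ip ip) A (xb, xb) 0.
Proof.
have Axb : A (xb, xb) = zeta%:E by rewrite Atilde_diag energy_limit.
split; first by rewrite Axb.
exists (fun i => (u (k i), y (k i))), (fun i => Aslope (k i)); split.
- exact: cvg_pair uk y_sub.
- rewrite Axb; under eq_fun do rewrite AmeritE.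
  by apply: cvg_EFin; [exact: nearW|exact: cvg_subseq merit_zeta].
- have [C C0 hC] := Aslope_norm.
  have q1 n : `|(Aslope n).1| <= C * (len n + len n.-1).
    apply: le_trans (hC n); rewrite -ler_sqr ?nnegrE ?sqrtr_ge0//.
    by rewrite hnorm_prod lerDl sqr_ge0.
  have q2 n : `|(Aslope n).2| <= C * (len n + len n.-1).
    apply: le_trans (hC n); rewrite -ler_sqr ?nnegrE ?sqrtr_ge0//.
    by rewrite hnorm_prod lerDr sqr_ge0.
  apply: cvg_subseq => //; apply: cvg_pair.
    exact: cvg0_of_norm_le q1 (len_sum_cvg0 C).
  exact: cvg0_of_norm_le q2 (len_sum_cvg0 C).
- by move=> i; exact: (Atilde_subgradP (prox _)).
Qed.

Lemma critical_energy : subdiff ip E xb 0.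
Proof.
split; first by rewrite energy_limit.
exists (fun i => y (k i)), (fun i => Eslope (k i)); split.
- exact: y_sub.
- rewrite energy_limit; have [K K0 hK] := M_bounded.
  have -> : (fun i => E (y (k i))) = (fun i => (merit (k i) - gap (y (k i) - u (k i)))%:E).
    by apply/funext => i; rewrite merit_gap addrK fineK// Ey_fin.
  apply: cvg_EFin; first exact: nearW.
  rewrite -[X in _ --> X]subr0; apply: cvgB; first exact: cvg_subseq merit_zeta.
  apply: (cvg0_of_norm_le (s := fun i => (gap_coef + 5 / 6 * K) * (len (k i) * len (k i)))).
    move=> i; rewrite ger0_norm ?gap_ge0// /gap [leRHS]mulrDl expr2 lerD2l.
    rewrite -[leRHS]mulrA ler_wpM2l//.
    by rewrite (le_trans (ip_le hip _ _))// mulrA ler_wpM2r// hK.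
  have -> : 0 = (gap_coef + 5 / 6 * K) * (0 * 0) by rewrite !mulr0.
  by apply: cvgMr; apply: cvgM; exact: cvg_subseq len_cvg0.
- have [C C0 hC] := Eslope_norm; apply: cvg_subseq => //.
  exact: cvg0_of_norm_le hC (len_sum_cvg0 C).
- by move=> i; exact: (energy_frechet (prox _)).
Qed.

(** * Convergence of the whole sequence *)

(** The factor 3 in Phi converts lengths of directions into lengths of steps, as
    1 + lam n <= 3. Half the radius e of the KL neighborhood is kept for y n, which
    is at distance len n from u n. *)
Lemma run_converges :
  u @ \oo --> xb /\ (\sum_(0 <= n <oo) `|u n.+1 - u n|%:E < +oo)%E.
Proof.
have [_ _ /(_ _ critical_Atilde) kl] := A_KL.
have [eta [U [psi [eta0 nO psiP klO]]]] := kl.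
have Axb : A (xb, xb) = zeta%:E by rewrite Atilde_diag energy_limit.
have [e /= e0 eO] : exists2 e : R, 0 < e & ball (xb, xb) e `<=` U by move/nbhs_ballP: nO.
have [c c0 hc] := sufficient_decrease; have [C C0 hC] := Aslope_norm.
pose s n := merit n - zeta.
have s0 n : 0 < s n by rewrite subr_gt0.
have scvg : s @ \oo --> 0.
  by rewrite -(subrr zeta); apply: cvgB => //; exact: cvg_cst.
have [N1 hN1] : exists N, forall n, (N <= n)%N -> ((s n)%:E < eta)%E.
  case: eta eta0 {psiP klO} => [r| |]//; last by exists 0%N => n _; rewrite ltry.
  by rewrite lte_fin => r0; have [N _ hN] := cvgr_lt _ scvg _ r0; exists N.
have e20 : 0 < e / 2 by rewrite divr_gt0.
have [N2 _ hN2] := cvgr_lt _ len_cvg0 _ e20.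
pose Phi n := 3 * (2 * (C / c) * psi (s n) + len n.-1 / 2).
have [_ psi_ge0 _ _ dpsi] := psiP.
apply: (finite_length_of_descent (Phi := Phi) (N0 := maxn N1 N2) e20).
- move=> n; rewrite geq_max => /andP[nN1 _].
  have p0 : 0 <= psi (s n) by apply: psi_ge0; split; [exact: ltW|exact: hN1].
  by rewrite mulr_ge0// addr_ge0// ?mulr_ge0 ?invr_ge0 ?(ltW C0) ?(ltW c0)// ltW// len_gt0.
- move=> n; rewrite geq_max => /andP[nN1 nN2] un.
  have dn : len n < e / 2 by exact: hN2.
  have On : U (u n, y n).
    apply: eO; split; rewrite -ball_normE /= distrC; first by lra.
    have := ler_normD (y n - u n) (u n - xb); rewrite subrKA -/(len n); lra.
  have [_ _ p0] := dpsi _ (s0 n) (hN1 _ nN1).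
  have := klO _ On; rewrite AmeritE Axb lte_fin => /(_ (zeta_lt n)).
  rewrite -lteBlDl// -EFinB => /(_ (hN1 _ nN1)) /=; rewrite -/(s n) => hkl.
  have h1 : 1 <= derive1 psi (s n) * (C * (len n + len n.-1)).
    rewrite -lee_fin EFinM; apply: (le_trans hkl); apply: lee_wpmul2l.
      by rewrite lee_fin ltW.
    by apply: (le_trans (dist0_le_Aslope n)); rewrite lee_fin.
  have h2 : c * len n ^+ 2 <= s n - s n.+1 by rewrite /s; have := hc n; lra.
  have h3 : derive1 psi (s n) * (s n - s n.+1) <= psi (s n) - psi (s n.+1).
    apply: (desingularizing_concave psiP) => //; [exact: ltW| |exact: hN1].
    by rewrite lerD2r ltW// merit_decr.
  have := kl_step c0 C0 p0 (ltW (len_gt0 n)) (ltW (len_gt0 n.-1)) h1 h2 h3.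
  by have := step_le n; rewrite /Phi /=; lra.
- move=> eps N eps0.
  have Phi0 : Phi @ \oo --> 0.
    have -> : 0 = 3 * (2 * (C / c) * 0 + 0 / 2) :> R by ring.
    apply: cvgMr; apply: cvgD; last by apply: cvgMl; exact: len_pred_cvg0.
    apply: cvgMr; apply: desingularizing_cvg0 psiP eta0 _ scvg.
    by move=> n; exact: ltW.
  have : (fun i => `|u (k i) - xb| + Phi (k i)) @ \oo --> 0.
    rewrite -(addr0 0); apply: cvgD; last exact: cvg_subseq Phi0.
    by rewrite -(normr0 X) -(subrr xb); apply: cvg_norm; apply: cvgB => //; exact: cvg_cst.
  move=> h; have [N3 _ hN3] := cvgr_lt _ h _ eps0.
  exists (k (maxn N N3)); first exact: leq_trans (leq_maxl _ _) (hk _).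
  by apply: hN3; exact: leq_maxr.
Qed.

End Cluster.

Lemma run_convergence :
  [/\ dist0 (prod_ip ip) (subdiff (prod_ip ip) A (u n, y n)) @[n --> \oo] --> 0%:E,
      [/\ decreasing_seq (fun n => A (u n, y n)), bounded_set (range u) &
          exists zeta : R, A (u n, y n) @[n --> \oo] --> zeta%:E] &
      (exists2 x, u @ \oo --> x & subdiff ip E x 0) /\
      (\sum_(0 <= n <oo) `|u n.+1 - u n|%:E < +oo)%E].
Proof.
have [zeta merit_zeta zeta_lt] := merit_cvg.
have [C uC] := u_bounded.
have [x [k [hk uk]]] := bounded_seq_cluster uC.
have [ux usum] := run_converges hk uk merit_zeta zeta_lt.
split; first exact: dist0_cvg0.
- split; first exact: A_decreasing.
    exists C; split; first exact: num_real.
    by move=> c Cc _ [n _ <-]; rewrite /= (le_trans (uC n))// ltW.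
  exists zeta; under eq_fun do rewrite AmeritE.
  by apply: cvg_EFin => //; exact: nearW.
- by split=> //; exists x => //; exact: critical_energy hk uk merit_zeta.
Qed.

End Flow.

Theorem theorem3 (R : realType) (X : normedVectType R) (ip : {dot X for idfun})
    (hip : forall x : X, `|x| = Num.sqrt (ip x x))
    (H : X -> \bar R) (F : X -> R) (f : X -> X) (M : {linear X -> X})
    (L dt alpha beta lmax : R)
    (Hproper : eproper H) (Hlsc : lower_semicontinuous H) (Hconvex : econvex H)
    (Fgrad : forall x, is_gradient ip F x (f x))
    (L_gt0 : 0 < L) (f_lipschitz : forall x y, `|f x - f y| <= L * `|x - y|)
    (E_level_bounded : level_bounded (energy H F))
    (M_selfadjoint : forall x y, ip (M x) y = ip x (M y))
    (M_psd : forall x, 0 <= ip (M x) x)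
    (dt_gt0 : 0 < dt) (dt_lt : dt < 2 / (3 * L))
    (alpha_gt0 : 0 < alpha) (beta_gt0 : 0 < beta) (beta_lt1 : beta < 1)
    (lmax_gt0 : 0 < lmax)
    (Atilde_KL : KL_function (prod_ip ip) (Atilde ip H F M L dt))
    (u y : nat -> X) (lam : nat -> R)
    (run : FlowBBApe_NLS ip H F f M dt alpha beta lmax u y lam)
    (lam_bound : forall n, 0 <= lam n <
       Num.min (Num.sqrt ((10 - 6 * dt * L) / (2 + 3 * dt * L)) - 1)
               (Num.sqrt 5 - 1)) :
  let A n := Atilde ip H F M L dt (u n, y n) in
  [/\ dist0 (prod_ip ip) (subdiff (prod_ip ip) (Atilde ip H F M L dt)
        (u n, y n)) @[n --> \oo] --> 0%:E,
      [/\ decreasing_seq A, bounded_set (range u) &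
          exists zeta : R, A n @[n --> \oo] --> zeta%:E] &
      (exists2 x, u @ \oo --> x & subdiff ip (energy H F) x 0) /\
      (\sum_(0 <= n <oo) `|u n.+1 - u n|%:E < +oo)%E].
Proof.
exact: (run_convergence hip Hproper Hconvex Fgrad L_gt0 f_lipschitz E_level_bounded
  M_selfadjoint M_psd dt_gt0 dt_lt alpha_gt0 beta_gt0 beta_lt1 lmax_gt0 Atilde_KL
  run lam_bound).
Qed.
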